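(* Let $I=[a,b]$ be a compact interval, let $(X,d)$ be a metric space, let $g:I\to\mathbb R$ be left-continuous and nondecreasing, let $\alpha>1$, and let $F:I\to\mathcal K(X)$ be $g$-Hölder of exponent $\alpha$. For every $a\le s<t\le b$, if $g$ is continuous on $[s,t]$, then $F$ is constant on $[s,t]$. In particular, if $g(t)=t$ on $I$, every map $F:I\to\mathcal K(X)$ that is $\alpha$-Hölder (with respect to $d_H$) with $\alpha>1$ is constant.
   Context: $\mathcal K(X)$ is the family of all nonempty compact subsets of $X$ with Hausdorff distance $d_H$. $F$ is $g$-Hölder of exponent $\alpha$ if there is $L\ge0$ with $d_H(F(s),F(t))\le L|g(t)-g(s)|^\alpha$ for all $s,t\in I$; $\alpha$-Hölder means this with $g(t)=t$. *)

(* Defs.v *)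
From HB Require Import structures.
From mathcomp Require Import all_boot all_order all_algebra.
From mathcomp Require Import all_classical all_reals all_analysis.

Set Implicit Arguments.
Unset Strict Implicit.
Unset Printing Implicit Defensive.

Import Order.TTheory GRing.Theory Num.Theory.
Import numFieldNormedType.Exports.

Local Open Scope classical_set_scope.
Local Open Scope ring_scope.

Definition nonempty_compacts {R : realType} (X : metricType R) : set (set X) :=
  [set K : set X | K !=set0 /\ compact K].
Arguments nonempty_compacts {R} X.

Definition dist_to_set {R : realType} {X : metricType R} (x : X) (B : set X) : R :=
  inf [set mdist x y | y in B].

(* [sup] and [inf] are real-valued, with value 0 when the bound does not exist;
   all of them exist when A and B are nonempty and compact. *)
Definition hausdorff_dist {R : realType} {X : metricType R} (A B : set X) : R :=
  Num.max (sup [set dist_to_set x B | x in A])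
          (sup [set dist_to_set y A | y in B]).

(* A map on [a, b] is represented by a function on R of which only the values
   on [a, b] are used. *)
Definition left_continuous_on {R : realType} (a b : R) (g : R -> R) : Prop :=
  {in `]a, b], forall t, g u @[u --> t^'-] --> g t}.

Definition g_holder {R : realType} {X : metricType R} (a b : R) (g : R -> R)
    (alpha : R) (F : R -> set X) : Prop :=
  exists2 L : R, 0 <= L &
    {in `[a, b] &, forall s t,
      hausdorff_dist (F s) (F t) <= L * `|g t - g s| `^ alpha}.

Definition holder {R : realType} {X : metricType R} (a b : R)
    (alpha : R) (F : R -> set X) : Prop :=
  g_holder a b (fun t => t) alpha F.

(* Main.v *)
(* Each halving step of the intermediate value theorem, combined with the
   triangle inequality for [hausdorff_dist], improves a bound
   [d_H (F x) (F y) <= C * |g y - g x|^alpha], valid for all [x, y] in [s, t],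
   to the same bound with [C] replaced by [2^(1 - alpha) * C]. Since
   [alpha > 1], the constant can be made arbitrarily small. *)
Require Import Defs.
From mathcomp Require Import all_boot all_order all_algebra.
From mathcomp Require Import all_classical all_reals all_analysis.
From mathcomp Require Import lra.
Set Implicit Arguments.
Unset Strict Implicit.
Unset Printing Implicit Defensive.
Import Order.TTheory GRing.Theory Num.Theory.
Import numFieldNormedType.Exports.
Local Open Scope classical_set_scope.
Local Open Scope ring_scope.

(** The triangle inequality, used in both directions, makes the distance to [x] 1-Lipschitz. *)
Lemma continuous_mdist (R : realType) (X : metricType R) (x : X) :
  continuous (mdist x : X -> R).
Proof.
move=> y; apply/cvgrPdist_lt => e e0.
apply/metricType_numDomainType.nbhs_mdistP; exists e => //= z yz.
rewrite /= ltr_norml; apply/andP; split.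
  by have := metric_triangle x y z; move: yz => /= yz; lra.
have := metric_triangle x z y; rewrite (metric_sym z y).
by move: yz => /= yz; lra.
Qed.

Section dist_to_set.
Context {R : realType} {X : metricType R}.
Implicit Types (x y : X) (A B C : set X).

Lemma dist_to_set_le x y B : B y -> dist_to_set x B <= mdist x y.
Proof.
by move=> By; apply: ge_inf; [exists 0 => _ [z _ <-]; exact: mdist_ge0|exists y].
Qed.

Lemma dist_to_set_ltP x B r : B !=set0 -> dist_to_set x B < r ->
  exists2 y, B y & mdist x y < r.
Proof.
move=> [y By] /inf_lt [|_ [z Bz <-] zr]; first by exists (mdist x y); exists y.
by exists z.
Qed.

Lemma dist_to_set_triangle x y C : C !=set0 ->
  dist_to_set x C <= mdist x y + dist_to_set y C.
Proof.
move=> C0; apply/ler_addgt0Pr => e e0.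
have [|z Cz yz] := @dist_to_set_ltP y C (dist_to_set y C + e) C0.
  by rewrite ltrDl.
have := dist_to_set_le x Cz; have := metric_triangle x y z; lra.
Qed.

(** This makes the suprema in [hausdorff_dist] genuine. The distance to [B] is at most the distance
    to one fixed [b] in [B], which is continuous and so bounded on the compact [A]. *)
Lemma compact_dist_to_set_ubound A B : compact A -> B !=set0 ->
  has_ubound [set dist_to_set x B | x in A].
Proof.
move=> cA [b Bb].
have /compact_bounded [M [_ /(_ (M + 1))]] : compact (mdist b @` A).
  apply: continuous_compact => //; apply: continuous_subspaceT.
  exact: continuous_mdist.
(* [compact_bounded] only certifies bounds strictly above [M], hence [M + 1]. *)
rewrite ltrDl ltr01 => /(_ isT) bM; exists (M + 1) => _ [x Ax <-].
apply: le_trans (dist_to_set_le x Bb) _; rewrite metric_sym.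
have := bM (mdist b x); rewrite /= ger0_norm ?mdist_ge0//; apply.
by exists x.
Qed.

End dist_to_set.

Section hausdorff_dist.
Context {R : realType} {X : metricType R}.
Implicit Types (A B C : set X).

Lemma hausdorff_distC A B : hausdorff_dist A B = hausdorff_dist B A.
Proof. by rewrite /hausdorff_dist maxC. Qed.

Lemma dist_to_set_le_hausdorff A B x : compact A -> B !=set0 -> A x ->
  dist_to_set x B <= hausdorff_dist A B.
Proof.
move=> cA B0 Ax; rewrite /hausdorff_dist le_max; apply/orP; left.
by apply: ub_le_sup; [exact: compact_dist_to_set_ubound|exists x].
Qed.

Lemma hausdorff_dist_le A B r : A !=set0 -> B !=set0 ->
  (forall x, A x -> dist_to_set x B <= r) ->
  (forall y, B y -> dist_to_set y A <= r) -> hausdorff_dist A B <= r.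
Proof.
move=> [a Aa] [b Bb] AB BA; rewrite /hausdorff_dist ge_max; apply/andP; split.
  by apply: ge_sup => [|_ [x Ax <-]]; [exists (dist_to_set a B); exists a|exact: AB].
by apply: ge_sup => [|_ [y By <-]]; [exists (dist_to_set b A); exists b|exact: BA].
Qed.

Lemma hausdorff_dist_triangle A B C : nonempty_compacts X A ->
  nonempty_compacts X B -> nonempty_compacts X C ->
  hausdorff_dist A C <= hausdorff_dist A B + hausdorff_dist B C.
Proof.
(* Pass through a point of [B'] that is nearest to [x] up to [e]. This bounds one of the two
   suprema; the other follows by exchanging the outer sets. *)
have one_sided (A' B' C' : set X) x : compact A' -> nonempty_compacts X B' ->
    C' !=set0 -> A' x ->
    dist_to_set x C' <= hausdorff_dist A' B' + hausdorff_dist B' C'.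
  move=> cA [B0 cB] C0 Ax; apply/ler_addgt0Pr => e e0.
  have [|y By xy] := @dist_to_set_ltP _ _ x B' (hausdorff_dist A' B' + e) B0.
    by rewrite (le_lt_trans (dist_to_set_le_hausdorff cA B0 Ax))// ltrDl.
  have := dist_to_set_triangle x y C0.
  have := dist_to_set_le_hausdorff cB C0 By; lra.
move=> [A0 cA] KB [C0 cC]; apply: hausdorff_dist_le => // x Kx.
  exact: one_sided.
by rewrite addrC (hausdorff_distC A) (hausdorff_distC B); exact: one_sided.
Qed.

(** Points of either set lie at distance 0 from the other, hence in its closure, and compact subsets
    of a metric space are closed. *)
Lemma hausdorff_dist_le0 A B : nonempty_compacts X A ->
  nonempty_compacts X B -> hausdorff_dist A B <= 0 -> A = B.
Proof.
have sub (A' B' : set X) : compact A' -> nonempty_compacts X B' ->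
    hausdorff_dist A' B' <= 0 -> A' `<=` B'.
  move=> cA [B0 cB] AB x Ax.
  have clB : closed B' := compact_closed (@metric_hausdorff _ X) cB.
  apply: clB => U /metricType_numDomainType.nbhs_mdistP [e /= e0 eU].
  have [|y By xy] := @dist_to_set_ltP _ _ x B' e B0.
    apply: le_lt_trans (dist_to_set_le_hausdorff cA B0 Ax) _.
    exact: le_lt_trans AB e0.
  by exists y; split => //; exact: eU.
move=> KA KB AB; apply/seteqP; split.
  by apply: sub => //; exact: KA.2.
by apply: sub; [exact: KB.2|exact: KA|rewrite hausdorff_distC].
Qed.

End hausdorff_dist.

Section holder_constant.
Context {R : realType} {X : metricType R}.
Variables (s t alpha : R) (g : R -> R) (F : R -> set X).
Hypothesis alpha1 : 1 < alpha.
Hypothesis cg : {within `[s, t], continuous g}.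
Hypothesis KF : {in `[s, t], forall u, nonempty_compacts X (F u)}.

Let holder_bound (C : R) := {in `[s, t] &, forall x y,
  hausdorff_dist (F x) (F y) <= C * `|g y - g x| `^ alpha}.

(** Supplies the point that splits the increment of [g] into two equal halves; this is where
    continuity of [g] enters. *)
Lemma IVT_midpoint x y : x \in `[s, t] -> y \in `[s, t] ->
  exists2 z, z \in `[s, t] & g z = (g x + g y) / 2.
Proof.
wlog xy : x y / x <= y => [H xI yI|].
  by case: (leP x y) => [|/ltW] /H; [apply|rewrite addrC; apply].
rewrite !in_itv /= => /andP[sx xt] /andP[sy yt].
have [||z] := @IVT R g x y ((g x + g y) / 2) xy.
- apply: continuous_subspaceW cg => u /=; rewrite !in_itv /=.
  by move=> /andP[xu uy]; apply/andP; split; [exact: le_trans xu|exact: le_trans yt].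
- by rewrite /Num.min /Num.max; case: ltP => gxy; apply/andP; split; lra.
rewrite !in_itv /= => /andP[xz zy] gz; exists z => //.
by rewrite in_itv /= (le_trans sx xz) (le_trans zy yt).
Qed.

Lemma holder_bound_half C :
  holder_bound C -> holder_bound (2^-1 `^ (alpha - 1) * C).
Proof.
move=> H x y xI yI; have [z zI gz] := IVT_midpoint xI yI.
have half0 : (0 : R) <= 2^-1 by rewrite invr_ge0.
(* In 2^(-alpha) = 2^(-1) * 2^(1 - alpha), the factor 2^(-1) is absorbed by adding the two equal
   bounds for the halves. *)
have powE : (`|g y - g x| / 2) `^ alpha =
    `|g y - g x| `^ alpha * (2^-1 * 2^-1 `^ (alpha - 1)).
  by rewrite powRM// mulr_powRB1// (lt_trans ltr01).
have Dx : `|g z - g x| = `|g y - g x| / 2.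
  by rewrite gz -[in RHS](ger0_norm half0) -normrM; congr `| _ |; lra.
have Dy : `|g y - g z| = `|g y - g x| / 2.
  by rewrite gz -[in RHS](ger0_norm half0) -normrM; congr `| _ |; lra.
apply: le_trans (hausdorff_dist_triangle (KF xI) (KF zI) (KF yI)) _.
apply: le_trans (lerD (H _ _ xI zI) (H _ _ zI yI)) _.
by rewrite Dx Dy powE; lra.
Qed.

Lemma holder_constant C :
  holder_bound C -> {in `[s, t] &, forall x y, F x = F y}.
Proof.
move=> HC x y xI yI; apply: hausdorff_dist_le0; [exact: KF|exact: KF|].
set q : R := 2^-1 `^ (alpha - 1).
have iter_bound n : holder_bound (q ^+ n * C).
  elim: n => [|n IH]; first by rewrite expr0 mul1r.
  by rewrite exprS -mulrA; exact: holder_bound_half.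
(* Here [alpha > 1] is decisive: a positive power of 1/2 stays below 1. *)
have q1 : `|q| < 1.
  rewrite ger0_norm ?powR_ge0//; have : q < 1 `^ (alpha - 1).
    apply: gt0_ltr_powR; rewrite ?subr_gt0// ?nnegrE ?invr_ge0//.
    by rewrite invf_lt1// ltr1n.
  by rewrite powR1.
have lim0 : geometric (C * `|g y - g x| `^ alpha) q n @[n --> \oo] --> (0 : R).
  exact: cvg_geometric.
(* The distance lies below every term of a geometric sequence tending to 0, so it is at most 0. *)
apply: (cvgr_to_ge lim0); apply: nearW => n.
by apply: le_trans (iter_bound n _ _ xI yI) _; rewrite /geometric /=; lra.
Qed.

End holder_constant.

Theorem corollary8p4 (R : realType) (X : metricType R) (a b : R) (hab : a <= b)
    (alpha : R) (halpha : 1 < alpha) :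
  (forall (g : R -> R) (F : R -> set X),
     left_continuous_on a b g ->
     {in `[a, b] &, {homo g : x y / x <= y}} ->
     {in `[a, b], forall t, nonempty_compacts X (F t)} ->
     g_holder a b g alpha F ->
     forall s t : R, a <= s -> s < t -> t <= b ->
       {within `[s, t], continuous g} ->
       {in `[s, t] &, forall x y, F x = F y}) /\
  (forall F : R -> set X,
     {in `[a, b], forall t, nonempty_compacts X (F t)} ->
     holder a b alpha F ->
     {in `[a, b] &, forall x y, F x = F y}).
Proof.
split=> [g F _ _ KF [L _ HL] s t ast st tb cg|F KF [L _ HL]].
  have sub : {subset `[s, t] <= `[a, b]}.
    by apply: subitvP; rewrite subitvE /= !bnd_simp ast tb.
  (* The Hölder constant [L] on the whole interval starts the iteration on the subinterval. *)
  apply: (@holder_constant _ _ s t alpha g F halpha cg _ L) => [u /sub /KF//|].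
  by move=> x y /sub xI /sub yI; exact: HL.
(* For the identity, continuity holds everywhere, so the subinterval can be all of [[a, b]]. *)
apply: (@holder_constant _ _ a b alpha id F halpha _ KF L HL).
by apply: continuous_subspaceT => x; exact: cvg_id.
Qed.
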